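(* Let $d,d_1,d_2\ge 1$, let $A_1,A_2\in\mathbb{M}_d$, $B_1\in\mathbb{M}_{d_1}$, $B_2\in\mathbb{M}_{d_2}$. Let $\Phi\in\mathcal{CP}[\mathbb{M}_d,\mathbb{M}_d;A_1,A_2]\subseteq\mathcal{CP}[\mathbb{M}_d,\mathbb{M}_d;A_2]$ be a map which has a minimal Kraus decomposition consisting of Hermitian Kraus operators, and let $\Psi\in\mathcal{CP}[\mathbb{M}_{d_1},\mathbb{M}_{d_2};B_1,B_2]$. If $\Phi$ is an extreme point of the set $\mathcal{CP}[\mathbb{M}_d,\mathbb{M}_d;A_2]$ and $\Psi$ is an extreme point of the set $\mathcal{CP}[\mathbb{M}_{d_1},\mathbb{M}_{d_2};B_1,B_2]$, then $\Phi\otimes\Psi$ is an extreme point of the set $\mathcal{CP}[\mathbb{M}_d\otimes\mathbb{M}_{d_1},\mathbb{M}_d\otimes\mathbb{M}_{d_2};A_1\otimes B_1,A_2\otimes B_2]$.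
   Context: $\mathbb{M}_{m\times n}$ is the space of complex $m\times n$ matrices, $\mathbb{M}_n=\mathbb{M}_{n\times n}$, and $I_n$ is the identity of $\mathbb{M}_n$; $\mathbb{M}_m\otimes\mathbb{M}_n$ is identified with $\mathbb{M}_{mn}$. A linear map $\Phi:\mathbb{M}_m\to\mathbb{M}_n$ is completely positive (CP) if $\mathrm{id}_k\otimes\Phi$ maps positive semidefinite matrices to positive semidefinite matrices for all $k\ge1$; equivalently, $\Phi=\sum_{j=1}^r \mathrm{Ad}_{V_j}$ for some $V_j\in\mathbb{M}_{m\times n}$, where $\mathrm{Ad}_V(X)=V^*XV$ (a Kraus decomposition with Kraus operators $V_j$). The Choi-rank $CR(\Phi)$ of a CP map is the smallest number of Kraus operators in a Kraus decomposition of $\Phi$; a Kraus decomposition is minimal if it has exactly $CR(\Phi)$ Kraus operators. $\Phi^*:\mathbb{M}_n\to\mathbb{M}_m$ is the dual map with respect to the Hilbert–Schmidt inner product: $\mathrm{tr}(\Phi(X)^*Y)=\mathrm{tr}(X^*\Phi^*(Y))$. For $C_1\in\mathbb{M}_m$, $C_2\in\mathbb{M}_n$: $\mathcal{CP}[\mathbb{M}_m,\mathbb{M}_n;C_2]=\{\Phi:\mathbb{M}_m\to\mathbb{M}_n \text{ linear}: \Phi\text{ is CP},\ \Phi(I_m)=C_2\}$ and $\mathcal{CP}[\mathbb{M}_m,\mathbb{M}_n;C_1,C_2]=\{\Phi:\mathbb{M}_m\to\mathbb{M}_n \text{ linear}: \Phi\text{ is CP},\ \Phi(I_m)=C_2,\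 \Phi^*(I_n)=C_1\}$. These are convex sets. $\Phi\otimes\Psi$ is the unique linear map with $(\Phi\otimes\Psi)(A\otimes B)=\Phi(A)\otimes\Psi(B)$. *)

(* Defs.v *)
From HB Require Import structures.
From mathcomp Require Import all_boot all_order all_algebra.
From mathcomp Require Import mxtens spectral.
From mathcomp Require Import classical_sets.

Set Implicit Arguments.
Unset Strict Implicit.
Unset Printing Implicit Defensive.

Import Order.TTheory GRing.Theory Num.Theory.
Local Open Scope ring_scope.
Local Open Scope sesquilinear_scope.
Local Open Scope classical_set_scope.

Section ExtremePoint.
Variables (C : numFieldType) (E : lmodType C).

(* When C is a field of complex numbers, 0 < t forces t to be real. *)
Definition extreme_point (S : set E) (x : E) : Prop :=
  S x /\
  forall (y z : E) (t : C), S y -> S z -> 0 < t < 1 ->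
    x = t *: y + (1 - t) *: z -> y = x /\ z = x.

End ExtremePoint.

Section Maps.
Variable C : numClosedFieldType.

Definition psdmx n (A : 'M[C]_n) : Prop :=
  A \is hermsymmx /\ forall v : 'cV[C]_n, 0 <= (v^t* *m A *m v) 0 0.

Section Tensor.
Variables m n p q : nat.
Variables (Phi : 'Hom('M[C]_m, 'M[C]_n)) (Psi : 'Hom('M[C]_p, 'M[C]_q)).

(* X is expanded on the basis of the products of matrix units; tenshomE and
   tenshom_unique below say that this gives Phi (x) Psi. *)
Definition tenshom_fun (X : 'M[C]_(m * p)) : 'M[C]_(n * q) :=
  \sum_i \sum_j X i j *:
    (Phi (delta_mx (mxtens_unindex i).1 (mxtens_unindex j).1)
     *t Psi (delta_mx (mxtens_unindex i).2 (mxtens_unindex j).2)).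

Fact tenshom_fun_linear : linear tenshom_fun.
Proof.
move=> a X Y; rewrite /tenshom_fun scaler_sumr -big_split; apply: eq_bigr => i _.
rewrite scaler_sumr -big_split; apply: eq_bigr => j _.
by rewrite !mxE scalerDl scalerA.
Qed.

HB.instance Definition _ :=
  GRing.isLinear.Build C 'M[C]_(m * p) 'M[C]_(n * q) *:%R tenshom_fun
    tenshom_fun_linear.

Definition tenshom : 'Hom('M[C]_(m * p), 'M[C]_(n * q)) := linfun tenshom_fun.

Lemma tenshomE (A : 'M[C]_m) (B : 'M[C]_p) :
  tenshom (A *t B) = Phi A *t Psi B.
Proof.
rewrite lfunE /= {2}(matrix_sum_delta A) {2}(matrix_sum_delta B).
rewrite !linear_sum /=; under [X in _ = X *t _]eq_bigr do rewrite linear_sum /=.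
under [X in _ = _ *t X]eq_bigr do rewrite linear_sum /=.
apply/matrixP => k l; rewrite /tenshom_fun !mxE !summxE.
under eq_bigr do rewrite summxE.
under [X in _ = X * _]eq_bigr do rewrite summxE.
under [X in _ = _ * X]eq_bigr do rewrite summxE.
rewrite mulr_sum; apply: eq_bigr => i _; rewrite mulr_sum; apply: eq_bigr => j _.
by rewrite !linearZ /= !mxE mulrACA.
Qed.

Lemma tenshom_unique (T : 'Hom('M[C]_(m * p), 'M[C]_(n * q))) :
  (forall A B, T (A *t B) = Phi A *t Psi B) -> T = tenshom.
Proof.
move=> TE; apply/lfunP => X; rewrite (matrix_sum_delta X) !linear_sum /=.
apply: eq_bigr => i _; rewrite !linear_sum /=; apply: eq_bigr => j _.
rewrite !linearZ /=; congr (_ *: _).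
case: (mxtens_indexP i) => i1 i2; case: (mxtens_indexP j) => j1 j2.
have -> : delta_mx (mxtens_index (i1, i2)) (mxtens_index (j1, j2))
          = delta_mx i1 j1 *t delta_mx i2 j2 :> 'M[C]_(m * p).
  apply/matrixP => k l; case: (mxtens_indexP k) => k1 k2.
  case: (mxtens_indexP l) => l1 l2; rewrite tensmxE !mxE.
  rewrite !(can_eq (@mxtens_indexK _ _)) !xpair_eqE -natrM mulnb.
  by rewrite andbACA.
by rewrite TE tenshomE.
Qed.

End Tensor.

Section Dual.
Variables m n : nat.
Variable Phi : 'Hom('M[C]_m, 'M[C]_n).

(* The (i, j) entry of Phi^*(Y) is tr (E_ij^* Phi^*(Y)) = tr (Phi(E_ij)^* Y). *)
Definition dualhom_fun (Y : 'M[C]_n) : 'M[C]_m :=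
  \matrix_(i, j) \tr ((Phi (delta_mx i j))^t* *m Y).

Fact dualhom_fun_linear : linear dualhom_fun.
Proof.
by move=> a X Y; apply/matrixP => i j; rewrite !mxE mulmxDr -scalemxAr linearP.
Qed.

HB.instance Definition _ :=
  GRing.isLinear.Build C 'M[C]_n 'M[C]_m *:%R dualhom_fun dualhom_fun_linear.

Definition dualhom : 'Hom('M[C]_n, 'M[C]_m) := linfun dualhom_fun.

Lemma dualhomE (X : 'M[C]_m) (Y : 'M[C]_n) :
  \tr ((Phi X)^t* *m Y) = \tr (X^t* *m dualhom Y).
Proof.
have -> : \tr (X^t* *m dualhom Y)
          = \sum_i \sum_j (X i j)^* * \tr ((Phi (delta_mx i j))^t* *m Y).
  rewrite lfunE /= /mxtrace exchange_big /=; apply: eq_bigr => j _.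
  by rewrite mxE; apply: eq_bigr => i _; rewrite !mxE.
rewrite {1}(matrix_sum_delta X) linear_sum /= raddf_sum /= raddf_sum /=.
rewrite mulmx_suml raddf_sum /=; apply: eq_bigr => i _.
rewrite linear_sum /= !raddf_sum /= mulmx_suml raddf_sum /=.
apply: eq_bigr => j _.
by rewrite !linearZ /= map_mxZ -scalemxAl linearZ.
Qed.

Lemma dualhom_unique (T : 'Hom('M[C]_n, 'M[C]_m)) :
  (forall X Y, \tr ((Phi X)^t* *m Y) = \tr (X^t* *m T Y)) -> T = dualhom.
Proof.
move=> TE; apply/lfunP => Y; apply/matrixP => i j.
have tr_delta (Z : 'M[C]_m) : \tr ((delta_mx i j)^t* *m Z) = Z i j.
  rewrite trmx_delta map_delta_mx /mxtrace (bigD1 j) //= big1 => [|k /negPf kj].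
    rewrite mxE (bigD1 i) //= big1 => [|l /negPf li].
      by rewrite mxE !eqxx mul1r !addr0.
    by rewrite mxE li andbF mul0r.
  by rewrite mxE big1 // => l _; rewrite mxE kj mul0r.
by rewrite -[LHS]tr_delta -TE dualhomE tr_delta.
Qed.

End Dual.

Section CompletelyPositive.
Variables m n : nat.

Definition completely_positive (Phi : 'Hom('M[C]_m, 'M[C]_n)) : Prop :=
  forall k : nat, (0 < k)%N -> forall X : 'M[C]_(k * m),
    psdmx X -> psdmx (tenshom (\1%VF : 'End('M[C]_k)) Phi X).

Definition kraus_decomposition (Phi : 'Hom('M[C]_m, 'M[C]_n)) (r : nat)
    (V : 'I_r -> 'M[C]_(m, n)) : Prop :=
  forall X : 'M[C]_m, Phi X = \sum_j (V j)^t* *m X *m V j.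

Definition choi_rank_is (Phi : 'Hom('M[C]_m, 'M[C]_n)) (r : nat) : Prop :=
  (exists V : 'I_r -> 'M[C]_(m, n), kraus_decomposition Phi V) /\
  forall (s : nat) (W : 'I_s -> 'M[C]_(m, n)),
    kraus_decomposition Phi W -> (r <= s)%N.

Definition minimal_kraus_decomposition (Phi : 'Hom('M[C]_m, 'M[C]_n))
    (r : nat) (V : 'I_r -> 'M[C]_(m, n)) : Prop :=
  kraus_decomposition Phi V /\ choi_rank_is Phi r.

Definition CP1 (C2 : 'M[C]_n) : set 'Hom('M[C]_m, 'M[C]_n) :=
  [set Phi | completely_positive Phi /\ Phi 1%:M = C2].

Definition CP2 (C1 : 'M[C]_m) (C2 : 'M[C]_n) : set 'Hom('M[C]_m, 'M[C]_n) :=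
  [set Phi | [/\ completely_positive Phi, Phi 1%:M = C2
             & dualhom Phi 1%:M = C1]].

End CompletelyPositive.
End Maps.

Arguments CP1 {C} m n C2.
Arguments CP2 {C} m n C1 C2.

(* Main.v *)
From HB Require Import structures.
Require Import Defs.
From mathcomp Require Import all_boot all_order all_algebra.
From mathcomp Require Import mxtens spectral complex.
From mathcomp Require Import boolp classical_sets reals.

Set Implicit Arguments.
Unset Strict Implicit.
Unset Printing Implicit Defensive.

Import Order.TTheory GRing.Theory Num.Theory.
Local Open Scope ring_scope.
Local Open Scope sesquilinear_scope.

(* Write sandwich V c for the map X |-> sum_ij c_ij V_i^* X V_j; its Choi
   matrix is M^* c M, where the rows of M are the vectorized V_i.  Following
   Choi and Landau-Streater, a CP map with Kraus operators V_i is extreme for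
   the constraint Phi(I) (resp. Phi(I) and Phi^*(I)) as soon as, and for a
   minimal family only if, c = 0 is the only c for which sandwich V c vanishes
   at I (resp. vanishes at I together with its dual).  For the products
   V_i (x) W_k, linear independence of the V_i^* V_j reduces both constraints to
   the corresponding ones on the blocks of c; on the dual side this requires
   independence of the V_i V_j^*, which is the same condition because the V_i
   are Hermitian.  The blocks then vanish by extremality of Psi. *)

(** * Adjoints, Gram matrices and positive semidefinite matrices *)

Section Matrices.
Variable C : numClosedFieldType.

Lemma trmxC_mul m n p (A : 'M[C]_(m, n)) (B : 'M[C]_(n, p)) :
  (A *m B)^t* = B^t* *m A^t*.
Proof. by rewrite trmx_mul map_mxM. Qed.

Lemma trmxCD m n (A B : 'M[C]_(m, n)) : (A + B)^t* = A^t* + B^t*.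
Proof. by rewrite linearD map_mxD. Qed.

Lemma trmxCZ m n a (A : 'M[C]_(m, n)) : (a *: A)^t* = a^* *: A^t*.
Proof. by rewrite linearZ map_mxZ. Qed.

Lemma trmxC_sum m n (I : finType) (A : I -> 'M[C]_(m, n)) :
  (\sum_i A i)^t* = \sum_i (A i)^t*.
Proof. by rewrite !raddf_sum. Qed.

Lemma trmxC1 n : (1%:M : 'M[C]_n)^t* = 1%:M.
Proof. by rewrite trmx1 map_mx1. Qed.

Lemma trmxC_tens m n p q (A : 'M[C]_(m, n)) (B : 'M[C]_(p, q)) :
  (A *t B)^t* = A^t* *t B^t*.
Proof. by rewrite trmx_tens map_mxT. Qed.

Lemma hermsymmxP n (A : 'M[C]_n) : reflect (A^t* = A) (A \is hermsymmx).
Proof.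
by apply: (iffP (is_hermitianmxP _ _ _)); rewrite expr0 scale1r => /esym.
Qed.

Lemma tensmx11 m n : 1%:M *t 1%:M = 1%:M :> 'M[C]_(m * n).
Proof.
apply/matrixP => i j; case: (mxtens_indexP i) => i1 i2.
case: (mxtens_indexP j) => j1 j2; rewrite tensmxE !mxE -natrM mulnb.
by rewrite (can_eq (@mxtens_indexK _ _)).
Qed.

Lemma hermsymmx_diagonalizable n (A : 'M[C]_n) : A \is hermsymmx ->
  exists (P : 'M[C]_n) (D : 'rV[C]_n), [/\ P^t* *m P = 1%:M, D \is a realmx
                & A = P^t* *m diag_mx D *m P].
Proof.
move=> Ah; exists (spectralmx A), (spectral_diag A); split.
- by rewrite -(mul1mx (_^t*)) mulmxKtV ?spectral_unitarymx.
- exact: hermitian_spectral_diag_real.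
- rewrite -invmx_unitary ?spectral_unitarymx //.
  exact/orthomx_spectralP/hermitian_normalmx.
Qed.

Lemma gram_diagE m n (B : 'M[C]_(m, n)) j :
  (B^t* *m B) j j = \sum_i `|B i j| ^+ 2.
Proof.
by rewrite mxE; apply: eq_bigr => i _; rewrite !mxE mulrC normCK.
Qed.

Lemma gram_diag_ge0 m n (B : 'M[C]_(m, n)) j : 0 <= (B^t* *m B) j j.
Proof. by rewrite gram_diagE sumr_ge0 // => i _; rewrite exprn_ge0. Qed.

Lemma gram_diag_eq0 m n (B : 'M[C]_(m, n)) :
  (forall j, (B^t* *m B) j j = 0) -> B = 0.
Proof.
move=> B0; apply/matrixP => i j; rewrite mxE.
have /eqP := B0 j; rewrite gram_diagE psumr_eq0 => [|k _]; last first.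
  by rewrite exprn_ge0.
by move=> /allP/(_ i (mem_index_enum _)); rewrite sqrf_eq0 normr_eq0 => /eqP.
Qed.

Lemma psdmx_gram m n (B : 'M[C]_(m, n)) : psdmx (B^t* *m B).
Proof.
split=> [|v]; first by apply/hermsymmxP; rewrite trmxC_mul trmxCK.
by rewrite -!mulmxA mulmxA -trmxC_mul gram_diag_ge0.
Qed.

Lemma diag_mx_gram n (D : 'rV[C]_n) : (forall k, 0 <= D 0 k) ->
  diag_mx D = (diag_mx (map_mx sqrtC D))^t* *m diag_mx (map_mx sqrtC D).
Proof.
move=> D0; rewrite tr_diag_mx map_diag_mx mulmx_diag; congr diag_mx.
apply/rowP => k; rewrite !mxE /= geC0_conj ?sqrtC_ge0 //.
by rewrite -expr2 sqrtCK.
Qed.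

(** By the spectral theorem A = P^* D P with P unitary and D nonnegative, and B = sqrt(D) P is a
    square root in the Gram sense. *)
Lemma psdmx_gramP n (A : 'M[C]_n) :
  psdmx A -> exists B : 'M[C]_n, A = B^t* *m B.
Proof.
case=> /hermsymmx_diagonalizable [P] [D] [PP _ ->] A0.
have PP' : P *m P^t* = 1%:M by apply: mulmx1C.
have D0 k : 0 <= D 0 k.
  (* The k-th column of P^* is a unit eigenvector, at which the quadratic form of A takes the value
     [D 0 k]. *)
  have := A0 (P^t* *m delta_mx k 0).
  rewrite trmxC_mul trmxCK !mulmxA -(mulmxA _ P) PP' mulmx1.
  rewrite -(mulmxA _ P) PP' mulmx1 trmx_delta map_delta_mx -rowE row_diag_mx.
  by rewrite -scalemxAl mul_delta_mx !mxE !eqxx mulr1.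
exists (diag_mx (map_mx sqrtC D) *m P).
by rewrite trmxC_mul diag_mx_gram // !mulmxA.
Qed.

Lemma psdmxD n (A B : 'M[C]_n) : psdmx A -> psdmx B -> psdmx (A + B).
Proof.
move=> [/hermsymmxP Ah A0] [/hermsymmxP Bh B0]; split=> [|v].
  by apply/hermsymmxP; rewrite trmxCD Ah Bh.
by rewrite mulmxDr mulmxDl mxE addr_ge0.
Qed.

Lemma psdmx0 n : psdmx (0 : 'M[C]_n).
Proof.
split=> [|v]; last by rewrite mulmx0 mul0mx mxE.
by apply/hermsymmxP; rewrite trmx0 map_mx0.
Qed.

Lemma psdmx_sum n (I : finType) (F : I -> 'M[C]_n) :
  (forall i, psdmx (F i)) -> psdmx (\sum_i F i).
Proof.
move=> F0; apply: (big_ind (@psdmx C n)) => //; first exact: psdmx0.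
exact: psdmxD.
Qed.

(** Since tA is dominated by M^* M, A vanishes on the kernel of M, so A factors through M on the
    right; as A is Hermitian, it also factors through M^* on the left. *)
Lemma psdmx_dominated n r (M : 'M[C]_(r, n)) (A B : 'M[C]_n) (t : C) :
    psdmx A -> psdmx B -> 0 < t < 1 ->
    M^t* *m M = t *: A + (1 - t) *: B ->
  exists b : 'M[C]_r, A = M^t* *m b *m M.
Proof.
move=> [/hermsymmxP Ah A0] Bp /andP[t0 t1] E.
have [a Ea] := psdmx_gramP (conj (introT (hermsymmxP _) Ah) A0).
have [b Eb] := psdmx_gramP Bp.
have AM : (A <= M)%MS.
  rewrite submxE; set N := cokermx M.
  have aN : a *m N = 0.
    (* The columns of N lie in the kernel of M, so N^* (tA + (1 - t)B) N = 0. Both summands have a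
       nonnegative diagonal, hence that of (aN)^* (aN) is zero. *)
    apply: gram_diag_eq0 => j; apply/eqP; rewrite eq_le gram_diag_ge0 andbT.
    rewrite -(pmulr_rle0 _ t0).
    have : N^t* *m (M^t* *m M) *m N = 0 by rewrite -!mulmxA mulmx_coker !mulmx0.
    rewrite E mulmxDr mulmxDl -!scalemxAr -!scalemxAl Ea Eb.
    have conjN (c : 'M_n) : N^t* *m (c^t* *m c) *m N = (c *m N)^t* *m (c *m N).
      by rewrite trmxC_mul !mulmxA.
    rewrite !conjN => /matrixP/(_ j j); rewrite mxE [X in X + _]mxE.
    rewrite [X in _ + X]mxE [RHS]mxE => /eqP; rewrite addr_eq0 => /eqP ->.
    by rewrite oppr_le0 mulr_ge0 ?gram_diag_ge0 // subr_ge0 ltW.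
  by rewrite Ea -mulmxA aN mulmx0.
have [N AN] : exists N, A *m N *m M = A by exists (pinvmx M); exact: mulmxKpV.
exists (N^t* *m A *m N).
have NA : M^t* *m N^t* *m A = A.
  by rewrite -{1}Ah -!trmxC_mul mulmxA AN Ah.
by rewrite !mulmxA NA AN.
Qed.

End Matrices.

Lemma mulmx_deltaE (R : pzSemiRingType) m n p q (A : 'M[R]_(m, n))
  (B : 'M[R]_(p, q)) i j a b : (A *m delta_mx i j *m B) a b = A a i * B j b.
Proof.
by rewrite -(mul_delta_mx (0 : 'I_1)) mulmxA -colE -mulmxA -rowE mxE big_ord1 !mxE.
Qed.

(** * Choi matrices and the maps [sandwich V c] *)

Section Sandwich.
Variable C : numClosedFieldType.
Variables m n : nat.

Definition choi (Phi : 'Hom('M[C]_m, 'M[C]_n)) : 'M[C]_(m * n) :=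
  \matrix_(i, j) Phi (delta_mx (mxtens_unindex i).1 (mxtens_unindex j).1)
                     (mxtens_unindex i).2 (mxtens_unindex j).2.

Lemma choiE Phi i a j b :
  choi Phi (mxtens_index (i, a)) (mxtens_index (j, b))
  = Phi (delta_mx i j) a b.
Proof. by rewrite mxE !mxtens_indexK. Qed.

Lemma choi_inj : injective choi.
Proof.
move=> Phi Psi /matrixP E; apply/lfunP => X.
rewrite (matrix_sum_delta X) !linear_sum; apply: eq_bigr => i _.
rewrite !linear_sum; apply: eq_bigr => j _; rewrite !linearZ; congr (_ *: _).
by apply/matrixP => a b; rewrite -!choiE E.
Qed.

Lemma choiD Phi Psi : choi (Phi + Psi) = choi Phi + choi Psi.
Proof. by apply/matrixP => i j; rewrite !mxE add_lfunE mxE. Qed.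

Lemma choiZ a Phi : choi (a *: Phi) = a *: choi Phi.
Proof. by apply/matrixP => i j; rewrite !mxE scale_lfunE mxE. Qed.

Definition sandwich_fun r (V : 'I_r -> 'M[C]_(m, n)) (c : 'M[C]_r)
    (X : 'M[C]_m) : 'M[C]_n :=
  \sum_i \sum_j c i j *: ((V i)^t* *m X *m V j).

Fact sandwich_fun_linear r (V : 'I_r -> 'M[C]_(m, n)) c :
  linear (sandwich_fun V c).
Proof.
move=> a X Y; rewrite /sandwich_fun scaler_sumr -big_split; apply: eq_bigr => i _.
rewrite scaler_sumr -big_split; apply: eq_bigr => j _ /=.
by rewrite mulmxDr mulmxDl scalerDr -scalemxAr -scalemxAl !scalerA mulrC.
Qed.

HB.instance Definition _ r V c :=
  GRing.isLinear.Build C 'M[C]_m 'M[C]_n *:%R (@sandwich_fun r V c)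
    (@sandwich_fun_linear r V c).

Definition sandwich r (V : 'I_r -> 'M[C]_(m, n)) c : 'Hom('M[C]_m, 'M[C]_n) :=
  linfun (sandwich_fun V c).

Lemma sandwichE r (V : 'I_r -> 'M[C]_(m, n)) c X :
  sandwich V c X = \sum_i \sum_j c i j *: ((V i)^t* *m X *m V j).
Proof. by rewrite lfunE. Qed.

Lemma sandwich_diag r (V : 'I_r -> 'M[C]_(m, n)) D X :
  sandwich V (diag_mx D) X = \sum_i D 0 i *: ((V i)^t* *m X *m V i).
Proof.
rewrite sandwichE; apply: eq_bigr => i _; rewrite (bigD1 i) //=.
rewrite big1 => [|j ji]; first by rewrite mxE eqxx addr0.
by rewrite mxE eq_sym (negPf ji) scale0r.
Qed.

Lemma sandwich1 r (V : 'I_r -> 'M[C]_(m, n)) X :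
  sandwich V 1%:M X = \sum_i (V i)^t* *m X *m V i.
Proof.
rewrite -diag_const_mx sandwich_diag.
by apply: eq_bigr => i _; rewrite mxE scale1r.
Qed.

Lemma kraus_sandwich r (V : 'I_r -> 'M[C]_(m, n)) Phi :
  kraus_decomposition Phi V <-> Phi = sandwich V 1%:M.
Proof.
split=> [E|-> X]; last exact: sandwich1.
by apply/lfunP => X; rewrite sandwich1 E.
Qed.

Definition krausmx r (V : 'I_r -> 'M[C]_(m, n)) : 'M[C]_(r, m * n) :=
  \matrix_(k, i) V k (mxtens_unindex i).1 (mxtens_unindex i).2.

Lemma choi_sandwich r (V : 'I_r -> 'M[C]_(m, n)) c :
  choi (sandwich V c) = (krausmx V)^t* *m c *m krausmx V.
Proof.
apply/matrixP => i j; rewrite mxE sandwichE summxE [RHS]mxE.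
under [RHS]eq_bigr do rewrite mxE mulr_suml.
rewrite exchange_big; apply: eq_bigr => k _; rewrite summxE.
apply: eq_bigr => l _; rewrite mxE mulmx_deltaE !mxE mulrA.
by congr (_ * _); rewrite mulrC.
Qed.

(** A linear change of the Kraus family acts on the coefficients by congruence, so diagonalizing the
    coefficient matrix amounts to choosing new operators. *)
Lemma sandwich_mix r s (V : 'I_r -> 'M[C]_(m, n)) (B : 'M[C]_(s, r)) e :
  sandwich (fun k => \sum_j B k j *: V j) e = sandwich V (B^t* *m e *m B).
Proof.
apply: choi_inj; rewrite !choi_sandwich.
have -> : krausmx (fun k => \sum_j B k j *: V j) = B *m krausmx V.
  apply/matrixP => k i; rewrite !mxE summxE.
  by apply: eq_bigr => j _; rewrite !mxE.
by rewrite trmxC_mul !mulmxA.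
Qed.

Lemma sandwich_linear r (V : 'I_r -> 'M[C]_(m, n)) a c e :
  sandwich V (a *: c + e) = a *: sandwich V c + sandwich V e.
Proof.
apply: choi_inj; rewrite choiD choiZ !choi_sandwich.
by rewrite mulmxDr mulmxDl -scalemxAr -scalemxAl.
Qed.

Lemma sandwich_adj r (V : 'I_r -> 'M[C]_(m, n)) c :
  sandwich V (c^t*) 1%:M = (sandwich V c 1%:M)^t*.
Proof.
rewrite !sandwichE trmxC_sum exchange_big; apply: eq_bigr => i _.
rewrite trmxC_sum; apply: eq_bigr => j _.
by rewrite trmxCZ !mxE !mulmx1 trmxC_mul trmxCK.
Qed.

Lemma cp_choi Phi : (0 < m)%N -> completely_positive Phi -> psdmx (choi Phi).
Proof.
move=> m_gt0 cpPhi.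
(* The Choi matrix is the image of the rank-one matrix sum_ij E_ij (x) E_ij. *)
have sumE q (F : 'I_m -> 'I_m -> 'M[C]_q) :
    \sum_i \sum_j (delta_mx i j *t F i j) =
    \matrix_(i, j) F (mxtens_unindex i).1 (mxtens_unindex j).1
                     (mxtens_unindex i).2 (mxtens_unindex j).2 :> 'M_(m * q).
  apply/matrixP => k l; rewrite !mxE summxE (bigD1 (mxtens_unindex k).1) //=.
  rewrite summxE (bigD1 (mxtens_unindex l).1) //= !mxE !eqxx mul1r.
  rewrite !big1 ?addr0 // => [i ik|j jl].
    rewrite summxE big1 // => j _; rewrite !mxE.
    by rewrite [_ == i]eq_sym (negPf ik) mul0r.
  by rewrite !mxE [_ == j]eq_sym (negPf jl) andbF mul0r.
have -> : choi Phi = tenshom \1%VF Phi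
    (\sum_i \sum_j (delta_mx i j *t delta_mx i j : 'M_(m * m))).
  rewrite linear_sum; under eq_bigr do rewrite linear_sum.
  under eq_bigr => i _.
    under eq_bigr => j _ do rewrite /= tenshomE id_lfunE.
    over.
  by rewrite sumE.
apply: cpPhi => //; rewrite sumE.
pose w : 'rV[C]_(m * m) :=
  \row_i ((mxtens_unindex i).2 == (mxtens_unindex i).1)%:R.
suff -> : \matrix_(i, j) delta_mx (mxtens_unindex i).1 (mxtens_unindex j).1
    (mxtens_unindex i).2 (mxtens_unindex j).2 = w^t* *m w :> 'M_(m * m).
  exact: psdmx_gram.
by apply/matrixP => i j; rewrite !mxE big_ord1 !mxE /= conjC_nat -natrM mulnb.
Qed.

End Sandwich.

(** * Kraus decompositions, duals and tensor products *)

Section Tensor.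
Variable C : numClosedFieldType.

Definition tens_family m n p q r s (V : 'I_r -> 'M[C]_(m, n))
    (W : 'I_s -> 'M[C]_(p, q)) (k : 'I_(r * s)) : 'M[C]_(m * p, n * q) :=
  V (mxtens_unindex k).1 *t W (mxtens_unindex k).2.

Lemma sum_mxtens_index (U : nmodType) r s (F : 'I_(r * s) -> U) :
  \sum_k F k = \sum_i \sum_j F (mxtens_index (i, j)).
Proof.
rewrite pair_big /= (reindex (@mxtens_index r s)) /=.
  by apply: eq_bigr => -[].
by exists (@mxtens_unindex r s) => k _; rewrite ?mxtens_indexK ?mxtens_unindexK.
Qed.

Lemma tensmx_sum m n p q (I J : finType) (F : I -> 'M[C]_(m, n))
    (G : J -> 'M[C]_(p, q)) :
  (\sum_i F i) *t (\sum_j G j) = \sum_i \sum_j F i *t G j.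
Proof.
apply/matrixP => k l; rewrite !mxE !summxE big_distrlr; apply: eq_bigr => i _.
by rewrite summxE; apply: eq_bigr => j _; rewrite mxE.
Qed.

Lemma tens_kraus m n p q r s (Phi : 'Hom('M[C]_m, 'M[C]_n))
    (Psi : 'Hom('M[C]_p, 'M[C]_q)) (V : 'I_r -> 'M_(m, n))
    (W : 'I_s -> 'M_(p, q)) :
  kraus_decomposition Phi V -> kraus_decomposition Psi W ->
  kraus_decomposition (tenshom Phi Psi) (tens_family V W).
Proof.
move=> PhiV PsiW; apply/kraus_sandwich/esym/tenshom_unique => A B.
rewrite sandwich1 PhiV PsiW tensmx_sum sum_mxtens_index.
apply: eq_bigr => i _; apply: eq_bigr => j _.
by rewrite /tens_family mxtens_indexK trmxC_tens !tensmx_mul.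
Qed.

(** The identity map has the single Kraus operator I, so id (x) Phi has the Kraus operators I (x)
    V_i, and each of them sends a Gram matrix to a Gram matrix. *)
Lemma kraus_cp m n r (Phi : 'Hom('M[C]_m, 'M[C]_n)) (V : 'I_r -> 'M_(m, n)) :
  kraus_decomposition Phi V -> completely_positive Phi.
Proof.
move=> PhiV k _ X /psdmx_gramP [B ->].
have idK : kraus_decomposition (\1%VF : 'End('M[C]_k)) (fun _ : 'I_1 => 1%:M).
  by move=> Y; rewrite id_lfunE big_ord1 trmxC1 mul1mx mulmx1.
rewrite (tens_kraus idK PhiV); apply: psdmx_sum => i.
by rewrite mulmxA -trmxC_mul -mulmxA; exact: psdmx_gram.
Qed.

Lemma sandwich_diag_kraus m n r (V : 'I_r -> 'M[C]_(m, n)) (D : 'rV_r) :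
    (forall k, 0 <= D 0 k) ->
  kraus_decomposition (sandwich V (diag_mx D)) (fun k => sqrtC (D 0 k) *: V k).
Proof.
move=> D0 X; rewrite sandwich_diag; apply: eq_bigr => i _.
rewrite trmxCZ -!scalemxAl -scalemxAr scalerA geC0_conj ?sqrtC_ge0 //.
by rewrite -expr2 sqrtCK.
Qed.

(** The Choi matrix is some B^* B; the rows of B, reshaped into m by n matrices, are Kraus
    operators. *)
Lemma cp_kraus m n (Phi : 'Hom('M[C]_m, 'M[C]_n)) :
    (0 < m)%N -> completely_positive Phi ->
  exists (r : nat) (V : 'I_r -> 'M_(m, n)), kraus_decomposition Phi V.
Proof.
move=> m_gt0 /(cp_choi m_gt0)/psdmx_gramP [B EB].
exists (m * n)%N, (fun k => \matrix_(i, j) B k (mxtens_index (i, j))).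
apply/kraus_sandwich/choi_inj; rewrite EB choi_sandwich mulmx1.
suff -> : krausmx (fun k => \matrix_(i, j) B k (mxtens_index (i, j))) = B by [].
apply/matrixP => k i; rewrite !mxE; congr (B k _).
exact: mxtens_unindexK.
Qed.

Lemma cp_minimal_kraus m n (Phi : 'Hom('M[C]_m, 'M[C]_n)) :
    (0 < m)%N -> completely_positive Phi ->
  exists (r : nat) (V : 'I_r -> 'M_(m, n)), minimal_kraus_decomposition Phi V.
Proof.
move=> m_gt0 /(cp_kraus m_gt0) [r0 [V0 PhiV0]].
(* Classical logic makes the existence of a decomposition of length r a boolean, so that [ex_minnP]
   can pick the least length. *)
pose P r := `[< exists V : 'I_r -> 'M_(m, n), kraus_decomposition Phi V >].
have exP : exists r, P r by exists r0; apply/asboolP; exists V0.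
case: (ex_minnP exP) => r /asboolP [V PhiV] rmin; exists r, V.
split=> //; split=> [|s W PhiW]; first by exists V.
by apply: rmin; apply/asboolP; exists W.
Qed.

Lemma dualhomD m n (Phi Psi : 'Hom('M[C]_m, 'M[C]_n)) Y :
  dualhom (Phi + Psi) Y = dualhom Phi Y + dualhom Psi Y.
Proof.
rewrite !lfunE /=; apply/matrixP => i j; rewrite !mxE.
by rewrite add_lfunE trmxCD mulmxDl linearD.
Qed.

(** The conjugate appears because Phi stands in the conjugate-linear argument of the Hilbert-Schmidt
    product. *)
Lemma dualhomZ m n a (Phi : 'Hom('M[C]_m, 'M[C]_n)) Y :
  dualhom (a *: Phi) Y = a^* *: dualhom Phi Y.
Proof.
rewrite !lfunE /=; apply/matrixP => i j; rewrite !mxE.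
by rewrite scale_lfunE trmxCZ -scalemxAl linearZ.
Qed.

(** Cyclicity of the trace moves the outer factors from X to Y, and the defining identity determines
    the dual. *)
Lemma dualhom_sandwich m n r (V : 'I_r -> 'M[C]_(m, n)) c :
  dualhom (sandwich V c) = sandwich (fun i => (V i)^t*) (map_mx Num.Def.conjC c).
Proof.
apply/esym/dualhom_unique => X Y; rewrite !sandwichE trmxC_sum.
rewrite mulmx_suml mulmx_sumr !raddf_sum; apply: eq_bigr => i _ /=.
rewrite trmxC_sum mulmx_suml mulmx_sumr !raddf_sum; apply: eq_bigr => j _ /=.
rewrite trmxCZ -scalemxAl -scalemxAr !linearZ /= mxE; congr (_ * _).
by rewrite !trmxC_mul trmxCK -!mulmxA mxtrace_mulC -!mulmxA.
Qed.

(** The dual has the adjoint Kraus operators, and (V_i (x) W_k)^* = V_i^* (x) W_k^*, so both sides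
    have the same Kraus decomposition. *)
Lemma dualhom_tens m n p q (Phi : 'Hom('M[C]_m, 'M[C]_n))
    (Psi : 'Hom('M[C]_p, 'M[C]_q)) r s (V : 'I_r -> 'M_(m, n))
    (W : 'I_s -> 'M_(p, q)) :
    kraus_decomposition Phi V -> kraus_decomposition Psi W ->
  dualhom (tenshom Phi Psi) = tenshom (dualhom Phi) (dualhom Psi).
Proof.
have dualK m' n' r' (Phi' : 'Hom('M[C]_m', 'M[C]_n')) (V' : 'I_r' -> _) :
    kraus_decomposition Phi' V' ->
    kraus_decomposition (dualhom Phi') (fun i => (V' i)^t*).
  move=> /kraus_sandwich ->; apply/kraus_sandwich.
  by rewrite dualhom_sandwich map_mx1.
move=> PhiV PsiW; have K1 := dualK _ _ _ _ _ (tens_kraus PhiV PsiW).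
have K2 := tens_kraus (dualK _ _ _ _ _ PhiV) (dualK _ _ _ _ _ PsiW).
apply/lfunP => X; rewrite K1 K2; apply: eq_bigr => k _.
by rewrite /tens_family trmxC_tens.
Qed.

(** For fixed x and y, the ((u, x), (v, y)) entries of the tensor sandwich at I form the matrix
    sum_ij b_ij V_i^* V_j, where b_ij is the (x, y) entry of the (i, j) block's sandwich at I.
    Independence of the V_i^* V_j forces every b_ij to vanish. *)
Lemma tens_family_sandwich m n p q r s (V : 'I_r -> 'M[C]_(m, n))
    (W : 'I_s -> 'M[C]_(p, q)) (c : 'M_(r * s)) :
    (forall a, sandwich V a 1%:M = 0 -> a = 0) ->
    sandwich (tens_family V W) c 1%:M = 0 ->
  forall i j, sandwich W
    (\matrix_(k, l) c (mxtens_index (i, k)) (mxtens_index (j, l))) 1%:M = 0.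
Proof.
move=> Vfree c0 i j.
pose blk i j :=
  sandwich W (\matrix_(k, l) c (mxtens_index (i, k)) (mxtens_index (j, l))) 1%:M.
rewrite -/(blk i j).
apply/matrixP => x y; rewrite [RHS]mxE.
suff /matrixP/(_ i j) : \matrix_(i, j) blk i j x y = 0 by rewrite !mxE.
apply: Vfree; apply/matrixP => u v; rewrite [RHS]mxE.
have <- : sandwich (tens_family V W) c 1%:M
    (mxtens_index (u, x)) (mxtens_index (v, y)) = 0 by rewrite c0 mxE.
rewrite !sandwichE !summxE sum_mxtens_index; apply: eq_bigr => i1 _.
rewrite summxE; under [RHS]eq_bigr do rewrite summxE sum_mxtens_index.
rewrite exchange_big; apply: eq_bigr => j1 _.
rewrite [LHS]mxE [X in X * _]mxE /blk sandwichE summxE mulr_suml.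
apply: eq_bigr => k _; rewrite summxE mulr_suml; apply: eq_bigr => l _.
rewrite /tens_family !mxtens_indexK trmxC_tens !mulmx1 tensmx_mul.
by rewrite [RHS]mxE tensmxE [X in X * _]mxE [X in X * _ * _]mxE mulrAC mulrA.
Qed.

End Tensor.

(** * Criteria for extreme points in terms of Kraus operators *)

Section Extremality.
Variable C : numClosedFieldType.

Lemma sandwich_diag_drop m n r (V : 'I_r -> 'M[C]_(m, n)) (D : 'rV_r) k0 :
    (forall k, 0 <= D 0 k) -> D 0 k0 = 0 ->
  exists W : 'I_r.-1 -> 'M_(m, n),
    kraus_decomposition (sandwich V (diag_mx D)) W.
Proof.
case: r V D k0 => [? ? [] //|r] V D k0 D0 Dk0.
exists (fun k => sqrtC (D 0 (lift k0 k)) *: V (lift k0 k)) => X.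
rewrite (sandwich_diag_kraus V D0) (bigD1_ord k0) //= Dk0 sqrtC0.
by rewrite scale0r mulmx0 add0r.
Qed.

(* Diagonalizing c gives Kraus operators W_k with
   Phi + e sandwich V c = sum_k (1 + e D_k) W_k^* X W_k.  For e = +-1/D_k0, with
   D_k0 the eigenvalue of largest modulus, these maps are CP, so both equal Phi
   by extremality; but for e = -1/D_k0 the term k0 vanishes, against
   minimality. *)
Lemma extreme_hermitian_free m n (S : set 'Hom('M[C]_m, 'M[C]_n)) Phi r
    (V : 'I_r -> 'M[C]_(m, n)) (c : 'M_r) :
    extreme_point S Phi -> minimal_kraus_decomposition Phi V ->
    c \is hermsymmx ->
    (forall t, t \is Num.real ->
       completely_positive (Phi + t *: sandwich V c) ->
       S (Phi + t *: sandwich V c)) ->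
  c = 0.
Proof.
move=> [_ ext] [/kraus_sandwich PhiV [_ rmin]].
move=> /hermsymmx_diagonalizable [P] [D] [PP /mxOverP Dreal Ec] Sc.
apply/eqP; apply: contraT => c_neq0.
have [k1 Dk1] : exists k, D 0 k != 0.
  apply/existsP; apply: contraNT c_neq0; rewrite negb_exists => /forallP D0.
  rewrite Ec (_ : D = 0) ?linear0 ?mulmx0 ?mul0mx //.
  by apply/rowP => k; rewrite mxE; apply/eqP; have := D0 k; rewrite negbK.
pose W k := \sum_j P k j *: V j.
have VW e : sandwich V (P^t* *m e *m P) = sandwich W e by rewrite sandwich_mix.
have [k0 Dmax] : exists k0, forall k, `|D 0 k| <= `|D 0 k0|.
  have normD : {in xpredT, forall k, `|D 0 k| \is Num.real}.
    by move=> k _; exact: normr_real.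
  have [k0 _ Dmax] := real_arg_maxP (isT : xpredT k1) normD.
  by exists k0 => k; apply: Dmax.
have Dk0 : D 0 k0 != 0.
  by rewrite -normr_gt0 (lt_le_trans _ (Dmax k1)) ?normr_gt0.
pose mu (e : C) := \row_k (1 + e * D 0 k).
(* As P^* P = I, Phi is also [sandwich W 1%:M], so Phi and its perturbation are diagonal in the same
   family. *)
have pertE e : Phi + e *: sandwich V c = sandwich W (diag_mx (mu e)).
  rewrite PhiV -PP -[X in X *m P]mulmx1 Ec !VW addrC -sandwich_linear.
  congr sandwich; rewrite -diag_const_mx -linearP; congr diag_mx.
  by apply/rowP => k; rewrite !mxE addrC.
have mu_ge0 e k : e \is Num.real -> `|e| = `|D 0 k0|^-1 -> 0 <= mu e 0 k.
  move=> er En; rewrite mxE addrC -lerBlDr sub0r.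
  have : `|e * D 0 k| <= 1.
    by rewrite normrM En mulrC ler_pdivrMr ?mul1r ?Dmax // normr_gt0.
  by rewrite real_ler_norml ?realM // => /andP[].
have Spert e : e \is Num.real -> `|e| = `|D 0 k0|^-1 ->
    S (Phi + e *: sandwich V c).
  move=> er En; apply: Sc => //; rewrite pertE.
  by apply: kraus_cp (sandwich_diag_kraus _ _) => k; exact: mu_ge0.
pose t := (D 0 k0)^-1.
have tr : t \is Num.real by rewrite realV.
have EPhi : Phi = 2^-1 *: (Phi + t *: sandwich V c)
    + (1 - 2^-1) *: (Phi + (- t) *: sandwich V c).
  have -> : 1 - 2^-1 = 2^-1 :> C.
    by rewrite [X in X - _](splitr 1) !div1r addrK.
  rewrite -scalerDr addrACA scaleNr subrr addr0 -mulr2n -scaler_nat scalerA.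
  by rewrite mulVf ?scale1r // pnatr_eq0.
have half : 0 < (2^-1 : C) < 1.
  by rewrite invr_gt0 ltr0n invf_lt1 ?ltr1n ?ltr0n.
have [] := ext _ _ _ (Spert t tr _) (Spert (- t) _ _) half EPhi.
- by rewrite normfV.
- by rewrite realN.
- by rewrite normrN normfV.
move=> _; rewrite pertE => PhiW.
have mut0 k : 0 <= mu (- t) 0 k by rewrite mu_ge0 ?realN ?normrN ?normfV.
have mut_k0 : mu (- t) 0 k0 = 0 by rewrite mxE mulNr mulVf // subrr.
have [W'] := sandwich_diag_drop W mut0 mut_k0.
by rewrite PhiW => /rmin; rewrite leqNgt ltn_predL (leq_ltn_trans _ (ltn_ord k0)).
Qed.

(** Both x + x^* and ix + (ix)^* are Hermitian and satisfy Q, so they vanish. Thus x^* = -x and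
    (ix)^* = -ix, whereas the first equation gives (ix)^* = ix; hence 2ix = 0. *)
Lemma hermitian_parts_eq0 n (Q : 'M[C]_n -> Prop) :
    (forall a x y, Q x -> Q y -> Q (a *: x + y)) ->
    (forall x, Q x -> Q (x^t*)) ->
    (forall x, x \is hermsymmx -> Q x -> x = 0) ->
  forall x, Q x -> x = 0.
Proof.
move=> Qlin Qadj Qherm x Qx.
have sym0 y : Q y -> y^t* = - y.
  move=> Qy; apply/eqP; rewrite -addr_eq0; apply/eqP; apply: Qherm.
    by apply/hermsymmxP; rewrite trmxCD trmxCK addrC.
  by rewrite -(scale1r (y^t*)); apply: Qlin => //; exact: Qadj.
have Qix : Q ('i *: x).
  have Q0 : Q 0 by have := Qlin (-1) _ _ Qx Qx; rewrite scaleN1r addNr.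
  by have := Qlin 'i _ _ Qx Q0; rewrite addr0.
have := sym0 _ Qix; rewrite trmxCZ sym0 // conjCi scalerN scaleNr opprK.
move/eqP; rewrite -addr_eq0 -mulr2n -scaler_nat scalerA scaler_eq0.
by rewrite mulf_eq0 pnatr_eq0 (negPf (neq0Ci _)) => /eqP.
Qed.

(** This is linear independence of the V_i^* V_j. If [sandwich V c] vanishes at I, adding multiples
    of it to Phi preserves the constraint; the Hermitian case then suffices because the condition on
    c is linear and stable under adjoints. *)
Lemma extreme_CP1_free m n (C2 : 'M[C]_n) (Phi : 'Hom('M[C]_m, 'M[C]_n)) r
    (V : 'I_r -> 'M[C]_(m, n)) :
    extreme_point (CP1 m n C2) Phi -> minimal_kraus_decomposition Phi V ->
  forall c, sandwich V c 1%:M = 0 -> c = 0.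
Proof.
move=> ext PhiV; apply: hermitian_parts_eq0 => [a x y Ex Ey|x Ex|x xh Ex].
- by rewrite sandwich_linear add_lfunE scale_lfunE Ex Ey scaler0 addr0.
- by rewrite sandwich_adj Ex trmx0 map_mx0.
- apply: (extreme_hermitian_free ext PhiV xh) => t _ cp; split=> //.
  by rewrite add_lfunE scale_lfunE Ex scaler0 addr0; case: ext => -[].
Qed.

Lemma extreme_CP2_free m n (C1 : 'M[C]_m) (C2 : 'M[C]_n)
    (Phi : 'Hom('M[C]_m, 'M[C]_n)) r (V : 'I_r -> 'M[C]_(m, n)) :
    extreme_point (CP2 m n C1 C2) Phi -> minimal_kraus_decomposition Phi V ->
  forall c, sandwich V c 1%:M = 0 /\ dualhom (sandwich V c) 1%:M = 0 -> c = 0.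
Proof.
move=> ext PhiV.
apply: hermitian_parts_eq0 => [a x y [Ex Fx] [Ey Fy]|x [Ex Fx]|x xh [Ex Fx]].
- rewrite sandwich_linear dualhomD dualhomZ add_lfunE scale_lfunE.
  by rewrite Ex Ey Fx Fy !scaler0 !addr0.
- split; first by rewrite sandwich_adj Ex trmx0 map_mx0.
  rewrite dualhom_sandwich -map_trmx sandwich_adj -dualhom_sandwich.
  by rewrite Fx trmx0 map_mx0.
- apply: (extreme_hermitian_free ext PhiV xh) => t _ cp.
  case: ext => -[_ E F] _; split=> //.
    by rewrite add_lfunE scale_lfunE Ex scaler0 addr0.
  by rewrite dualhomD dualhomZ Fx scaler0 addr0.
Qed.

(** Any Y in a convex decomposition of Phi has its Choi matrix dominated by a multiple of that of
    Phi, hence is [sandwich V b]. Then Y - Phi has coefficients b - I and vanishes at I together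
    with its dual, so b = I. *)
Lemma free_extreme_CP2 m n (C1 : 'M[C]_m) (C2 : 'M[C]_n)
    (Phi : 'Hom('M[C]_m, 'M[C]_n)) r (V : 'I_r -> 'M[C]_(m, n)) :
    (0 < m)%N -> CP2 m n C1 C2 Phi -> kraus_decomposition Phi V ->
    (forall c, sandwich V c 1%:M = 0 -> dualhom (sandwich V c) 1%:M = 0 ->
       c = 0) ->
  extreme_point (CP2 m n C1 C2) Phi.
Proof.
move=> m_gt0 PhiS /kraus_sandwich PhiV free; split=> // Y Z t.
(* By the symmetry exchanging t and 1 - t, it is enough to identify the first component. *)
suff main Y' Z' t' : CP2 m n C1 C2 Y' -> CP2 m n C1 C2 Z' -> 0 < t' < 1 ->
    Phi = t' *: Y' + (1 - t') *: Z' -> Y' = Phi.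
  move=> YS ZS t01 E; split; first exact: main E.
  apply: (main Z Y (1 - t)) => //; last by rewrite subKr addrC.
  by case/andP: t01 => t0 t1; rewrite subr_gt0 t1 ltrBlDr ltrDl.
move=> [Ycp Y1 Yd] [Zcp _ _] t01 E.
have [b Yb] : exists b, choi Y' = (krausmx V)^t* *m b *m krausmx V.
  apply: (psdmx_dominated (cp_choi m_gt0 Ycp) (cp_choi m_gt0 Zcp) t01).
  by rewrite -choiZ -choiZ -choiD -E PhiV choi_sandwich mulmx1.
have {}Yb : Y' = sandwich V b by apply: choi_inj; rewrite choi_sandwich.
have EY : Y' - Phi = sandwich V (b - 1%:M).
  rewrite -(scaleN1r Phi) -(scaleN1r 1%:M) [b + _]addrC sandwich_linear.
  by rewrite -PhiV -Yb addrC.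
case: PhiS => _ P1 Pd.
suff /eqP : b - 1%:M = 0 by rewrite subr_eq0 => /eqP b1; rewrite Yb b1 PhiV.
apply: free; rewrite -EY.
  by rewrite add_lfunE opp_lfunE Y1 P1 subrr.
by rewrite -scaleN1r dualhomD dualhomZ rmorphN1 scaleN1r Yd Pd subrr.
Qed.

End Extremality.

Theorem theorem3p5 (R : realType) (d d1 d2 : nat)
    (hd : (1 <= d)%N) (hd1 : (1 <= d1)%N) (hd2 : (1 <= d2)%N)
    (A1 A2 : 'M[R[i]]_d) (B1 : 'M[R[i]]_d1) (B2 : 'M[R[i]]_d2)
    (Phi : 'Hom('M[R[i]]_d, 'M[R[i]]_d))
    (Psi : 'Hom('M[R[i]]_d1, 'M[R[i]]_d2))
    (hPhi : CP2 d d A1 A2 Phi)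
    (hKraus : exists (r : nat) (V : 'I_r -> 'M[R[i]]_d),
        minimal_kraus_decomposition Phi V /\
        forall j : 'I_r, V j \is hermsymmx)
    (hPsi : CP2 d1 d2 B1 B2 Psi)
    (hPhi_ext : extreme_point (CP1 d d A2) Phi)
    (hPsi_ext : extreme_point (CP2 d1 d2 B1 B2) Psi) :
  extreme_point (CP2 (d * d1) (d * d2) (A1 *t B1) (A2 *t B2))
    (tenshom Phi Psi).
Proof.
have [r [V [minV hermV]]] := hKraus.
have [Psicp Psi1 Psid] := hPsi; have [_ Phi1 Phid] := hPhi.
have [s [W minW]] := cp_minimal_kraus hd1 Psicp.
have Vfree := extreme_CP1_free hPhi_ext minV.
have Wfree := extreme_CP2_free hPsi_ext minW.
have [PhiV PsiW] : kraus_decomposition Phi V /\ kraus_decomposition Psi W.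
  by case: minV => ? _; case: minW.
have TU := tens_kraus PhiV PsiW.
have Vadj : (fun j => (V j)^t*) = V.
  by apply/funext => j; exact/hermsymmxP.
apply: (free_extreme_CP2 _ _ TU) => [||c c1 cd].
- by rewrite muln_gt0 hd hd1.
- split; first exact: kraus_cp TU.
    by rewrite -tensmx11 tenshomE Phi1 Psi1.
  by rewrite (dualhom_tens PhiV PsiW) -tensmx11 tenshomE Phid Psid.
(* The adjoint family still has V as its left factor, so [Vfree] also splits the dual constraint
   into blocks. *)
have Uadj : (fun k => (tens_family V W k)^t*)
    = tens_family V (fun k => (W k)^t*).
  by rewrite -{2}Vadj; apply/funext => k; exact: trmxC_tens.
rewrite dualhom_sandwich Uadj in cd.
have c1' := tens_family_sandwich Vfree c1.
have cd' := tens_family_sandwich Vfree cd.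
apply/matrixP => k l; case: (mxtens_indexP k) => i k'.
case: (mxtens_indexP l) => j l'; rewrite [RHS]mxE.
suff /matrixP/(_ k' l') :
    \matrix_(k, l) c (mxtens_index (i, k)) (mxtens_index (j, l)) = 0.
  by rewrite !mxE.
apply: Wfree; split; first exact: c1'.
(* The dual carries conjugated coefficients, and conjugation commutes with taking a block. *)
rewrite dualhom_sandwich -[RHS](cd' i j).
by congr (sandwich _ _ _); apply/matrixP => x y; rewrite !mxE.
Qed.
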